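(* Let $T$ be a finite rooted tree with node set $\mathcal V$, cost function $c:\mathcal V\to\mathbb R_{\ge0}$, integer budget $B\ge1$, and importance function $r:\mathcal V\to\mathbb R_{>0}$. Let $\mathbf v$ be a nonempty hypernode with $\mathrm{Cost}(T_{\mathbf v})>0$, and let $\mathcal X(\mathbf v)$ be the set of all sequences $(\mathbf x_1,\dots,\mathbf x_m)$ such that, with $\mathbf x_0=\mathbf v$, the sequence $\mathbf x_0,\mathbf x_1,\dots,\mathbf x_m$ is produced with positive probability as the full sequence of hypernodes by the SEI algorithm started at $\mathbf v$. Assume that $\mathrm{Cost}(T_{S(\mathbf u)})>0$ for every hypernode $\mathbf u$ with $S(\mathbf u)\neq\emptyset$ appearing in such a sequence. Then \[\mathrm{CV}^2\big(|\mathbf v|C_{\mathrm{SEI}}(T_{\mathbf v})\big)\le\max_{(\mathbf x_1,\dots,\mathbf x_m)\in\mathcal X(\mathbf v)}\alpha(\mathbf v,\mathbf x_1,\dots,\mathbf x_m)-1.\]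
   Context: For a node $v$, $S(v)$ is its set of children and $T_v$ is the subtree rooted at $v$, with $\mathrm{Cost}(T_v)=\sum_{u\in T_v}c(u)$. A hypernode is a set of distinct nodes of $T$ all at the same depth. For a set of nodes $\mathbf v$: $c(\mathbf v)=\sum_{v\in\mathbf v}c(v)$, $r(\mathbf v)=\sum_{v\in\mathbf v}r(v)$, $S(\mathbf v)=\bigcup_{v\in\mathbf v}S(v)$, $T_{\mathbf v}=\bigcup_{v\in\mathbf v}T_v$, and $\mathrm{Cost}(T_{\mathbf v})=\sum_{v\in\mathbf v}\mathrm{Cost}(T_v)$. The hyperchildren of $\mathbf v$ are $H(\mathbf v)=\{\mathbf w\subseteq S(\mathbf v): |\mathbf w|=\min(B,|S(\mathbf v)|)\}$. For a random variable $X$ with $\mathbb E[X]>0$, $\mathrm{CV}^2(X)=\mathrm{Var}(X)/\mathbb E[X]^2$. SEI algorithm started at $\mathbf v$: set $k=0$, $\mathbf x_0=\mathbf v$, $D=1$, $C=c(\mathbf x_0)/|\mathbf x_0|$. Repeat: if $S(\mathbf x_k)=\emptyset$, stop and output $C_{\mathrm{SEI}}(T_{\mathbf v})=C$. Otherwise choose $\mathbf x_{k+1}\in H(\mathbf x_k)$ by first choosing $x\in S(\mathbf x_k)$ with probability $r(x)/r(S(\mathbf x_k))$ and then choosing the remaining $\min(B,|S(\mathbf x_k)|)-1$ elements of $\mathbf x_{k+1}$ as a uniformly random subset of $S(\mathbf x_k)\setminus\{x\}$ (fresh randomness at each step); set $D_k=\frac{|\mathbf x_{k+1}|}{|\mathbf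 x_k|}\cdot\frac{r(S(\mathbf x_k))}{r(\mathbf x_{k+1})}$, $D\leftarrow D\cdot D_k$, $C\leftarrow C+\frac{c(\mathbf x_{k+1})}{|\mathbf x_{k+1}|}D$, $k\leftarrow k+1$. The estimator $|\mathbf v|C_{\mathrm{SEI}}(T_{\mathbf v})$ has mean $\mathrm{Cost}(T_{\mathbf v})$. For a sequence of hypernodes $\mathbf x_0,\dots,\mathbf x_m$ with $\mathbf x_i\in H(\mathbf x_{i-1})$, define \[\alpha(\mathbf x_0,\dots,\mathbf x_m)=\prod_{i=1}^m\frac{r(S(\mathbf x_{i-1}))}{r(\mathbf x_i)}\cdot\frac{\mathrm{Cost}(T_{\mathbf x_i})}{\mathrm{Cost}(T_{S(\mathbf x_{i-1})})}\] (an empty product equals $1$). *)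

(* Defs.v *)
From mathcomp Require Import all_boot all_order all_algebra.

Set Implicit Arguments.
Unset Strict Implicit.
Unset Printing Implicit Defensive.

Import Order.TTheory GRing.Theory Num.Theory.
Local Open Scope ring_scope.

(* The root is encoded as the fixed point of [parent]; since every node reaches
   it, it is the only fixed point and [parent] has no other cycle. *)
Record rootedTree (V : finType) := RootedTree {
  root : V;
  parent : V -> V;
  parent_root : parent root = root;
  parent_connect : forall u : V, fconnect parent u root
}.

Section Tree.
Variables (V : finType) (T : rootedTree V).
Implicit Types (u : V) (v : {set V}).

Definition depth u : nat := findex (parent T) u (root T).

Definition children u : {set V} :=
  [set x | (x != root T) && (parent T x == u)].

Definition subtree u : {set V} := [set x | fconnect (parent T) x u].

Definition hypernode v : Prop := {in v &, forall x y, depth x = depth y}.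

Definition succs v : {set V} := \bigcup_(u in v) children u.

Definition hyperchildren (B : nat) v : {set {set V}} :=
  [set w : {set V} | (w \subset succs v) && (#|w| == minn B #|succs v|)].

End Tree.

Section SEI.
Variables (R : realFieldType) (V : finType) (T : rootedTree V).
Variables (c r : V -> R) (B : nat).
Implicit Types (v w x y : {set V}) (s : seq {set V}).

Definition wt (f : V -> R) v : R := \sum_(u in v) f u.

Definition subtree_cost (u : V) : R := \sum_(x in subtree T u) c x.

Definition Cost v : R := \sum_(u in v) subtree_cost u.

Definition completions v (a : V) : {set {set V}} :=
  [set y : {set V} | (y \subset succs T v :\ a)
                     && (#|y| == (minn B #|succs T v|).-1)].

(* Probability that the next hypernode after [v] is [w]: a first element [a] is
   drawn with probability proportional to [r], then it is completed by a
   uniformly random element of [completions v a]. *)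
Definition step_prob v w : R :=
  \sum_(a in succs T v) r a / wt r (succs T v) *
    \sum_(y in completions v a) #|completions v a|%:R^-1 * (w == a |: y)%:R.

Lemma step_prob_hyperchildren v w :
  (0 < B)%N -> step_prob v w != 0 -> w \in hyperchildren T B v.
Proof.
move=> B0; apply: contraR => wH; rewrite /step_prob big1 // => a aS.
rewrite big1 ?mulr0 // => y.
rewrite inE => /andP[yS /eqP cy]; case: eqP wH => [->|]; last by rewrite mulr0.
rewrite inE negb_and => /orP[].
  by rewrite subUset sub1set aS /= (subset_trans yS (subsetDl _ _)).
rewrite cardsU1 cy.
have -> : a \notin y by apply/negP => /(subsetP yS); rewrite !inE eqxx.
by rewrite add1n prednK ?eqxx // leq_min B0 (cardD1 a) aS.
Qed.

(* [run_prob v s] is the probability that [v :: s] is the full sequence of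
   hypernodes produced by the algorithm started at [v]. *)
Fixpoint run_prob v s : R :=
  if succs T v == set0 then (nilp s)%:R
  else if s is w :: s' then step_prob v w * run_prob w s' else 0.

Fixpoint sei_loop x (D C : R) s : R :=
  if s is y :: s' then
    let Dk := #|y|%:R / #|x|%:R * (wt r (succs T x) / wt r y) in
    let D' := D * Dk in
    sei_loop y D' (C + wt c y / #|y|%:R * D') s'
  else C.

(* The output of the algorithm as a function of the hypernodes it selects. *)
Definition C_SEI v s : R := sei_loop v 1 (wt c v / #|v|%:R) s.

(* The sample space: successive hypernodes lie at increasing depths, so that a
   run started at a nonempty hypernode selects fewer than #|V| new ones. *)
Definition run := #|V|.-bseq {set V}.

Definition mean v (X : seq {set V} -> R) : R :=
  \sum_(s : run) run_prob v s * X s.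

Definition variance v (X : seq {set V} -> R) : R :=
  mean v (fun s => (X s - mean v X) ^+ 2).

Definition CV2 v (X : seq {set V} -> R) : R := variance v X / mean v X ^+ 2.

Definition possible_runs v : {set run} := [set s : run | 0 < run_prob v s].

Definition alpha v s : R :=
  \prod_(p <- zip (v :: s) s)
    (wt r (succs T p.1) / wt r p.2 * (Cost p.2 / Cost (succs T p.1))).

(* The default value 0 is harmless when [c] and [r] are nonnegative: then
   [alpha] is nonnegative, and a nonempty hypernode has at least one possible
   run if moreover [r] is positive and 0 < [B]. *)
Definition max_alpha v : R :=
  \big[Num.max/0]_(s in possible_runs v) alpha v s.

End SEI.

(* Main.v *)
Require Import Defs.
From mathcomp Require Import all_boot all_order all_algebra.
From mathcomp Require Import ring lra.

(* Write X(v) for |v| C_SEI(T_v) and W(v, w) = r(S(v)) / r(w).  Given a first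
   step from v to w, X(v) = c(v) + W(v, w) X(w), and a hypernode w is drawn
   with probability proportional to r(w), so that W(v, w) f(w) has mean f(S(v))
   for every additive f.  Taking f = Cost, this gives by induction both
   E X(v) = Cost(T_v) and E alpha = 1; the latter shows that the maximum M(v)
   of alpha is at least 1.  Moreover
     (W(v, w) Cost(T_w) / Cost(T_S(v))) M(w) <= M(v),
   so that E X(w)^2 <= M(w) Cost(T_w)^2 bounds the mean of (W(v, w) X(w))^2 by
   M(v) Cost(T_S(v))^2.  Expanding the square then gives
   E X(v)^2 <= c(v)^2 + 2 c(v) Cost(T_S(v)) + M(v) Cost(T_S(v))^2
            <= M(v) Cost(T_v)^2. *)

Set Implicit Arguments.
Unset Strict Implicit.
Unset Printing Implicit Defensive.

Import Order.TTheory GRing.Theory Num.Theory.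
Local Open Scope ring_scope.

(** * Depths, ancestors and subtree costs *)

Section Tree.
Variables (V : finType) (T : rootedTree V).
Implicit Types (u w x : V) (v : {set V}).

Lemma depth_root : depth T (Defs.root T) = 0%N.
Proof. exact: findex0. Qed.

Lemma depth_eq0 x : (depth T x == 0%N) = (x == Defs.root T).
Proof. exact: findex_eq0. Qed.

Lemma depth_parent x : depth T (parent T x) = (depth T x).-1.
Proof.
have [->|xr] := eqVneq x (Defs.root T); first by rewrite parent_root depth_root.
by rewrite [depth T x]/depth fconnect_findex ?parent_connect // eq_sym.
Qed.

Lemma depth_iter k x : depth T (iter k (parent T) x) = (depth T x - k)%N.
Proof. by elim: k => [|k IH]; rewrite
  ?subn0 // iterS depth_parent IH subnS. Qed.

Lemma depth_lt_card x : (depth T x < #|V|)%N.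
Proof.
exact: leq_trans (findex_max (parent_connect T x)) (max_card _).
Qed.

Lemma depth_children u x : x \in children T u -> depth T x = (depth T u).+1.
Proof.
rewrite inE => /andP[xr /eqP <-].
by rewrite depth_parent prednK // lt0n depth_eq0.
Qed.

(** Each parent step lowers the depth by one until the root is reached, so the two depths determine
    the number of steps. *)
Lemma ancestor_iter x w : fconnect (parent T) x w ->
  (depth T w <= depth T x)%N /\ iter (depth T x - depth T w) (parent T) x = w.
Proof.
move=> /iter_findex; set k := findex _ _ _ => xw.
have dw : depth T w = (depth T x - k)%N by rewrite -xw depth_iter.
rewrite dw leq_subr; split=> //; have [kx|xk] := leqP k (depth T x).
  by rewrite subKn.
(* With more steps than the depth of [x], the path has ended at the root, so [w] is the root. *)
have dw0 : depth T w = 0%N by rewrite dw; apply/eqP; rewrite subn_eq0 ltnW.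
rewrite (eqP (ltnW xk : (depth T x - k == 0)%N)) subn0.
move/eqP: dw0; rewrite depth_eq0 => /eqP ->.
exact: iter_findex (parent_connect T x).
Qed.

Lemma mem_succs v x :
  (x \in succs T v) = (x != Defs.root T) && (parent T x \in v).
Proof.
apply/bigcupP/andP => [[u uv]|[xr xv]];
  first by rewrite inE => /andP[-> /eqP ->].
by exists (parent T x) => //; rewrite inE xr eqxx.
Qed.

(** Here [n] acts as fuel: depths stay below [#|V|] and grow by one per generation, so each
    generation consumes one unit. *)
Lemma depth_succs v n :
  {in v, forall u, (#|V| <= depth T u + n.+1)%N} ->
  {in succs T v, forall x, (#|V| <= depth T x + n)%N}.
Proof.
move=> vn x; rewrite mem_succs => /andP[xr /vn].
by rewrite depth_parent addnS -addSn prednK // lt0n depth_eq0.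
Qed.

Lemma succs_eq0 v :
  {in v, forall u, (#|V| <= depth T u + 0)%N} -> succs T v = set0.
Proof.
move=> v0; apply/setP => x; rewrite inE mem_succs.
by apply/negbTE/andP => -[_ /v0]; rewrite addn0 leqNgt depth_lt_card.
Qed.

Variables (R : realFieldType) (c : V -> R).

Lemma subtree_cost_children u :
  subtree_cost T c u = c u + \sum_(w in children T u) subtree_cost T c w.
Proof.
rewrite /subtree_cost (big_setD1 u) /= ?inE ?connect0 //; congr (_ + _).
(* [p x] is the ancestor of [x] one level below [u], that is, the child of [u] whose subtree
   contains [x]; it partitions the proper descendants of [u]. *)
pose p x := iter (depth T x - (depth T u).+1) (parent T) x.
rewrite (partition_big p (mem (children T u))) /= => [|x].
  apply: eq_bigr => w wu; have dw := depth_children wu.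
  apply: eq_bigl => x; rewrite !inE; apply/idP/idP.
    by case/andP=> _ /eqP <-; apply: (fconnect_iter (parent T)).
  move=> xw; have [dwx] := ancestor_iter xw; rewrite dw -/(p x) => ->.
  rewrite eqxx andbT; apply/andP; split.
    by apply: contraTneq dwx => ->; rewrite dw ltnn.
  apply: connect_trans xw _; move: wu; rewrite inE => /andP[_ /eqP <-].
  exact: fconnect1.
rewrite !inE => /andP[xu] /ancestor_iter[dux eu].
have {}dux : (depth T u < depth T x)%N.
  rewrite ltn_neqAle dux andbT; apply: contraNneq xu => dE.
  by rewrite -eu dE subnn.
rewrite -[parent T (p x)]iterS /p -subSn // subSS eu eqxx andbT.
by rewrite -depth_eq0 depth_iter subKn.
Qed.

Lemma Cost_succs v : Cost T c v = wt c v + Cost T c (succs T v).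
Proof.
rewrite /Cost /wt (eq_bigr _ (fun u _ => subtree_cost_children u)) big_split /=.
congr (_ + _).
rewrite [RHS](partition_big (parent T) (mem v)) /= => [|x]; last first.
  by rewrite mem_succs => /andP[].
apply: eq_bigr => u uv; apply: eq_bigl => x; rewrite inE mem_succs -andbA.
by case: (parent T x =P u) => [->|]; rewrite ?uv ?andbF.
Qed.

Lemma Cost_ge0 v : (forall u, 0 <= c u) -> 0 <= Cost T c v.
Proof. by move=> c0; do 2!apply: sumr_ge0 => ? _. Qed.

End Tree.

(** * The law of a single step of the algorithm *)

Section Sampling.
Variables (R : realFieldType) (V : finType) (T : rootedTree V).
Variables (r : V -> R) (B : nat).
Hypothesis r_gt0 : forall u, 0 < r u.
Hypothesis B_gt0 : (0 < B)%N.
Implicit Types (v w : {set V}) (s : seq {set V}).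

Lemma wt_ge0 v : 0 <= wt r v.
Proof. by apply: sumr_ge0 => u _; apply: ltW. Qed.

Lemma wt_gt0 v : v != set0 -> 0 < wt r v.
Proof.
case/set0Pn=> u uv; rewrite /wt (big_setD1 u) //= ltr_pwDl //; exact: wt_ge0.
Qed.

(** The number of completions of a first element, the same for every choice of that element; also
    the number of hyperchildren containing a given child. *)
Let step_bin v := 'C(#|succs T v|.-1, (minn B #|succs T v|).-1).

Lemma step_bin_gt0 v : succs T v != set0 -> (0 < step_bin v)%N.
Proof.
by rewrite -card_gt0 => S0; rewrite bin_gt0
  -ltnS !prednK ?geq_minr // leq_min B_gt0.
Qed.

Lemma card_completions v a : a \in succs T v ->
  #|completions T B v a| = step_bin v.
Proof. by move=> aS; rewrite cards_draws /step_bin (cardsD1 a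
  (succs T v)) aS. Qed.

Lemma setU1_completions_inj v a :
  {in completions T B v a &, injective (fun y : {set V} => a |: y)}.
Proof.
have notin (y : {set V}) : y \in completions T B v a -> a \notin y.
  by rewrite inE => /andP[/subsetP ys _]; apply/negP => /ys; rewrite !inE eqxx.
by move=> y z /notin ay /notin az yz; rewrite -(setU1K ay) yz setU1K.
Qed.

Lemma setU1_completions v a : a \in succs T v ->
  [set a |: y | y in completions T B v a]
    = [set w in hyperchildren T B v | a \in w].
Proof.
move=> aS.
have m0 : (0 < minn B #|succs T v|)%N by rewrite leq_min B_gt0 (cardD1 a) aS.
apply/setP => w; rewrite !inE; apply/imsetP/andP.
  move=> [y]; rewrite inE subsetD1 => /andP[/andP[yS ay] /eqP cy] ->.
  by rewrite setU11 subUset sub1set aS yS cardsU1 ay cy add1n prednK ?eqxx.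
case=> /andP[wS /eqP cw] aw; exists (w :\ a); last by rewrite setD1K.
by rewrite inE setSD //= -cw [in X in _ == X](cardsD1 a) aw.
Qed.

(** For each first element [a] of [w], exactly one completion, [w :\ a], yields [w]. Summing [r a]
    over these [a] produces [wt r w]. *)
Lemma step_probE v w : step_prob T r B v w =
  (w \in hyperchildren T B v)%:R * (wt r w / wt r (succs T v))
    / (step_bin v)%:R.
Proof.
have -> : step_prob T r B v w =
  \sum_(a in succs T v) r a / wt r (succs T v) / (step_bin v)%:R
     * ((w \in hyperchildren T B v) && (a \in w))%:R.
  apply: eq_bigr => a aS; rewrite -[RHS]mulrA; congr (_ * _).
  rewrite card_completions // -mulr_sumr; congr (_ * _).
  have -> : (w \in hyperchildren T B v) && (a \in w)
      = (w \in [set a |: y | y in completions T B v a]).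
    by rewrite setU1_completions // [RHS]inE.
  have [/imsetP[y yC ->]|wN] := boolP (w \in _).
    rewrite (big_setD1 y) //= eqxx big1 ?addr0 // => z.
    rewrite !inE => /andP[zy zC]; case: eqP => // /setU1_completions_inj E.
    by rewrite -(E v) ?eqxx // inE in zy.
  rewrite big1 // => y yC; case: eqP wN => // ->.
  by rewrite imset_f.
have [wH|_] := boolP (w \in _); last first.
  by rewrite !mul0r big1 // => a _; rewrite mulr0.
rewrite mul1r /wt !mulr_suml big_mkcond [RHS]big_mkcond /=.
apply: eq_bigr => a _; have [aw|_] := boolP (a \in w); last first.
  by rewrite mulr0 if_same.
move: wH; rewrite inE => /andP[/subsetP/(_ a aw) -> _].
by rewrite mulr1.
Qed.

Lemma step_prob_ge0 v w : 0 <= step_prob T r B v w.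
Proof. by rewrite step_probE !(mulr_ge0, invr_ge0, ler0n, wt_ge0). Qed.

Lemma hyperchildren_neq0 v w :
  succs T v != set0 -> w \in hyperchildren T B v -> w != set0.
Proof.
rewrite inE -!card_gt0 => S0 /andP[_ /eqP ->].
by rewrite leq_min B_gt0.
Qed.

(** Double counting: each child of [v] lies in [step_bin v] hyperchildren. *)
Lemma sum_hyperchildren v (g : V -> R) :
  \sum_(w in hyperchildren T B v) wt g w
    = (step_bin v)%:R * wt g (succs T v).
Proof.
rewrite /wt (exchange_big_dep (mem (succs T v))) /= => [|w a]; last first.
  by rewrite inE => /andP[/subsetP wS _] /wS.
rewrite mulr_sumr; apply: eq_bigr => a aS.
rewrite sumr_const [RHS]mulr_natl; congr (_ *+ _).
rewrite -(card_completions aS) -(card_in_imset (@setU1_completions_inj v a)).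
by rewrite setU1_completions //; apply: eq_card => w; rewrite [RHS]inE.
Qed.

(** Unbiasedness of importance sampling: the factor [wt r w] of [step_prob] cancels the denominator
    of the ratio, which leaves the double count [sum_hyperchildren]. *)
Lemma sum_step_prob_wt v (g : V -> R) : succs T v != set0 ->
  \sum_w step_prob T r B v w * (wt r (succs T v) / wt r w * wt g w)
    = wt g (succs T v).
Proof.
move=> S0; have k0 : (step_bin v)%:R != 0 :> R.
  by rewrite pnatr_eq0 -lt0n step_bin_gt0.
rewrite -[RHS](mulKf k0) -sum_hyperchildren mulr_sumr [RHS]big_mkcond /=.
apply: eq_bigr => w _; rewrite step_probE.
case: ifP => [wH|]; last by rewrite !mul0r.
have rw := lt0r_neq0 (wt_gt0 (hyperchildren_neq0 S0 wH)).
by rewrite mul1r; field; rewrite k0 rw lt0r_neq0 // wt_gt0.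
Qed.

(** The case [g = r] of the preceding identity, divided by [wt r (succs T v)]. *)
Lemma sum_step_prob v : succs T v != set0 -> \sum_w step_prob T r B v w = 1.
Proof.
move=> S0; have rS := lt0r_neq0 (wt_gt0 S0).
apply: (mulIf rS); rewrite mul1r -[RHS](sum_step_prob_wt r S0) mulr_suml.
apply: eq_bigr => w _; rewrite step_probE.
have [wH|_] := boolP (w \in _); last by rewrite !mul0r.
by rewrite mulfVK // lt0r_neq0 // wt_gt0 // (hyperchildren_neq0 S0).
Qed.

Lemma run_prob_ge0 v s : 0 <= run_prob T r B v s.
Proof.
elim: s v => [|w s IH] v /=; case: ifP => _ //.
by rewrite mulr_ge0 ?step_prob_ge0.
Qed.

End Sampling.

(** * Sums over sequences of bounded length *)

Lemma big_bseqS (R : nmodType) (A : finType) n (F : seq A -> R) :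
  \sum_(s : n.+1.-bseq A) F s
    = F [::] + \sum_(a : A) \sum_(s : n.-bseq A) F (a :: s).
Proof.
(* Removing the head changes the type of a bounded sequence, so both sides are moved to
   duplicate-free lists of plain sequences and compared up to permutation. *)
pose runs m := [seq val s | s <- index_enum (m.-bseq A : finType)].
have sumE m (G : seq A -> R) : \sum_(s : m.-bseq A) G s
  = \sum_(s <- runs m) G s.
  by rewrite big_map.
have runs_uniq m : uniq (runs m).
  by rewrite map_inj_uniq ?index_enum_uniq //; apply: val_inj.
have mem_runs m s : (s \in runs m) = (size s <= m)%N.
  apply/mapP/idP => [[t _ ->]|sm]; first exact: size_bseq.
  by exists (Bseq sm); rewrite ?mem_index_enum.
under [in RHS]eq_bigr => a _ do rewrite (sumE n (fun s => F (a :: s))).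
rewrite (sumE n.+1 F).
rewrite -(big_allpairs_dep (h := fun a s => a :: s) (r2 := fun=> runs n)).
rewrite -(big_cons _ _ _ _ xpredT F) /=; apply/perm_big/uniq_perm => //=.
  rewrite allpairs_uniq ?index_enum_uniq ?andbT //; last first.
    by move=> [a s] [b t] _ _ /= [-> ->].
  by apply/allpairsP => -[[a s] []].
move=> s; rewrite mem_runs inE; case: s => [|a s]; rewrite ?eqxx //=.
apply/idP/allpairsP => [sn|[[b t] /= [_ tn [_ ->]]]].
  by exists (a, s); rewrite /= mem_index_enum mem_runs.
by rewrite ltnS -mem_runs.
Qed.

(** * Expectations over runs, by recursion on the first step *)

Section Estimator.
Variables (R : realFieldType) (V : finType) (T : rootedTree V).
Variables (c r : V -> R) (B : nat).
Hypothesis c_ge0 : forall u, 0 <= c u.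
Hypothesis r_gt0 : forall u, 0 < r u.
Hypothesis B_gt0 : (0 < B)%N.
Implicit Types (v w : {set V}) (s : seq {set V}) (X : seq {set V} -> R).

Notation p := (step_prob T r B).

(* [mean] is the case [n = #|V|]; bounding the length of a run by [n] makes
   induction possible, and loses no run when [deep n v] holds. *)
Definition mean_upto n v X : R :=
  \sum_(s : n.-bseq {set V}) run_prob T r B v s * X s.

Definition deep n v := {in v, forall u, (#|V| <= depth T u + n)%N}.

Lemma sum_step_le v (F G : {set V} -> R) :
  (forall w, 0 < p v w -> F w <= G w) ->
  \sum_w p v w * F w <= \sum_w p v w * G w.
Proof.
move=> FG; apply: ler_sum => w _.
have := step_prob_ge0 T r_gt0 B_gt0 v w; rewrite le_eqVlt => /predU1P[<-|pw].
  by rewrite !mul0r.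
by rewrite ler_pM2l // FG.
Qed.

Lemma sum_step_eq v (F G : {set V} -> R) :
  (forall w, 0 < p v w -> F w = G w) ->
  \sum_w p v w * F w = \sum_w p v w * G w.
Proof.
by move=> FG; apply: le_anti; rewrite !sum_step_le // => w /FG ->.
Qed.

(** Induction along a run. The leaf case ranges over all [n] because a run may stop with fuel left;
    with no fuel, [deep] forces a leaf. *)
Lemma run_ind (P : nat -> {set V} -> Prop) :
  (forall n v, deep n v -> succs T v = set0 -> P n v) ->
  (forall n v, deep n.+1 v -> succs T v != set0 ->
     (forall w, 0 < p v w -> deep n w /\ P n w) -> P n.+1 v) ->
  forall n v, deep n v -> P n v.
Proof.
move=> leaf step; elim=> [|n IH] v dv; first exact/leaf/succs_eq0.
have [/leaf|S0] := eqVneq (succs T v) set0; first exact.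
apply: step => // w pw.
have dw : deep n w.
  have := step_prob_hyperchildren B_gt0 (lt0r_neq0 pw).
  rewrite inE => /andP[/subsetP wS _] u /wS; exact: depth_succs dv _.
by split=> //; apply: IH.
Qed.

Lemma mean_upto_leaf n v X : succs T v = set0 -> mean_upto n v X = X [::].
Proof.
move=> S0; have nil0 : (size ([::] : seq {set V}) <= n)%N by [].
rewrite /mean_upto (bigD1 (Bseq nil0)) //= S0 eqxx mul1r big1 ?addr0 //.
by case=> -[|w s] i //=; rewrite S0 eqxx mul0r.
Qed.

Lemma mean_upto_step n v X : succs T v != set0 ->
  mean_upto n.+1 v X = \sum_w p v w * mean_upto n w (fun s => X (w :: s)).
Proof.
move=> S0; rewrite /mean_upto.
rewrite (big_bseqS n (fun s => run_prob T r B v s * X s)) /=.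
rewrite (negbTE S0) mul0r add0r; apply: eq_bigr => w _.
by rewrite mulr_sumr; apply: eq_bigr => s _; rewrite mulrA.
Qed.

Lemma eq_mean_upto n v X Y : X =1 Y -> mean_upto n v X = mean_upto n v Y.
Proof. by move=> XY; apply: eq_bigr => s _; rewrite XY. Qed.

Lemma mean_upto_add n v X Y :
  mean_upto n v (fun s => X s + Y s) = mean_upto n v X + mean_upto n v Y.
Proof. by rewrite -big_split; apply: eq_bigr => s _; rewrite mulrDr. Qed.

Lemma mean_upto_scale n v a X :
  mean_upto n v (fun s => a * X s) = a * mean_upto n v X.
Proof. by rewrite mulr_sumr; apply: eq_bigr => s _; rewrite mulrCA. Qed.

(** Under [deep], truncating the length loses no probability mass. *)
Lemma mean_upto1 n v : deep n v -> mean_upto n v (fun=> 1) = 1.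
Proof.
move: n v; apply: run_ind => [n v _ /mean_upto_leaf -> //|n v _ S0 IH].
rewrite mean_upto_step // -[RHS](sum_step_prob r_gt0 B_gt0 S0).
rewrite -[RHS](eq_bigr _ (fun w _ => mulr1 _)).
by apply: sum_step_eq => w /IH[].
Qed.

Lemma mean_upto_cst n v a : deep n v -> mean_upto n v (fun=> a) = a.
Proof.
move=> /mean_upto1 E; rewrite -[RHS]mulr1 -E -mean_upto_scale.
by apply: eq_mean_upto => s; rewrite mulr1.
Qed.

Lemma mean_upto_sqr n v a b X : deep n v ->
  mean_upto n v (fun s => (a + b * X s) ^+ 2)
    = a ^+ 2 + 2 * a * b * mean_upto n v X
      + b ^+ 2 * mean_upto n v (fun s => X s ^+ 2).
Proof.
move=> dv; rewrite -{1}(mean_upto_cst (a ^+ 2) dv).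
rewrite -!mean_upto_scale -!mean_upto_add.
by apply: eq_mean_upto => s; ring.
Qed.

Lemma exists_run n v : deep n v ->
  exists s : n.-bseq {set V}, 0 < run_prob T r B v s.
Proof.
move=> /mean_upto1; pose P (s : n.-bseq _) := 0 < run_prob T r B v s.
case: (pickP P); rewrite /P.
  by move=> s; exists s.
move=> run0; rewrite /mean_upto big1 => [/esym/eqP|s _]; first
  by rewrite oner_eq0.
have := run_prob_ge0 T r_gt0 B_gt0 v s.
by rewrite le_eqVlt run0 orbF => /eqP <-; rewrite mul0r.
Qed.

(** * The estimator and its mean *)

Definition weight v w : R := wt r (succs T v) / wt r w.

Lemma weight_ge0 v w : 0 <= weight v w.
Proof. by rewrite divr_ge0 ?wt_ge0. Qed.

Lemma sum_step_Cost v : succs T v != set0 ->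
  \sum_w p v w * (weight v w * Cost T c w) = Cost T c (succs T v).
Proof. exact: sum_step_prob_wt. Qed.

Definition estimator v s : R := #|v|%:R * C_SEI T c r v s.

(** The loop is affine in its accumulators, which lets its tail be compared with a fresh start. *)
Lemma sei_loopE v D C s :
  sei_loop T c r v D C s = C + D * sei_loop T c r v 1 0 s.
Proof.
elim: s v D C => [|w s IH] v D C /=; first by rewrite mulr0 addr0.
by rewrite IH [in RHS]IH; ring.
Qed.

Lemma estimator_nil v : estimator v [::] = wt c v.
Proof.
rewrite /estimator /C_SEI /=; have [->|v0] := eqVneq v set0.
  by rewrite cards0 mul0r /wt big_set0.
by rewrite mulrC divfK // pnatr_eq0 cards_eq0.
Qed.

(** The cardinality ratios in the factors [Dk] telescope against the factor [#|v|], so only [weight]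
    survives. For empty [v] both sides are 0. *)
Lemma estimator_cons v w s :
  estimator v (w :: s) = wt c v + weight v w * estimator w s.
Proof.
rewrite /estimator /C_SEI /=; have [->|v0] := eqVneq v set0.
  rewrite /weight cards0 mul0r /wt big_set0 /succs big_set0 big_set0.
  by rewrite !mul0r addr0.
have {v0} : #|v|%:R != 0 :> R by rewrite pnatr_eq0 cards_eq0.
rewrite /weight sei_loopE [in RHS]sei_loopE.
(* Hiding these quotients leaves [#|v|] as the only denominator. *)
move: (_ / wt r w) (wt c w / _) => W q v0.
by field.
Qed.

Lemma mean_estimator n v : deep n v -> mean_upto n v (estimator v) = Cost T c v.
Proof.
move: n v; apply: run_ind => [n v _ S0|n v _ S0 IH].
  by rewrite mean_upto_leaf // estimator_nil Cost_succs S0 /Cost big_set0 addr0.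
rewrite mean_upto_step // Cost_succs -(sum_step_Cost S0).
(* The cost of [v] is spread over the possible first steps, whose probabilities sum to 1, to compare
   term by term. *)
rewrite -[wt c v]mulr1 -(sum_step_prob r_gt0 B_gt0 S0) mulr_sumr -big_split /=.
under [RHS]eq_bigr do rewrite [wt c v * _]mulrC -mulrDr.
apply: sum_step_eq => w /IH[dw <-].
rewrite -[X in X + _](mean_upto_cst _ dw) -mean_upto_scale -mean_upto_add.
by apply: eq_mean_upto => s; rewrite estimator_cons.
Qed.

(** * The mean and the maximum of [alpha] *)

Lemma alpha_nil v : alpha T c r v [::] = 1.
Proof. by rewrite /alpha big_nil. Qed.

Lemma alpha_cons v w s : alpha T c r v (w :: s) =
  weight v w * (Cost T c w / Cost T c (succs T v)) * alpha T c r w s.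
Proof. by rewrite /alpha big_cons. Qed.

Definition Cost_pos n v := forall s : n.-bseq {set V}, 0 < run_prob T r B v s ->
  forall u, u \in v :: s -> succs T u != set0 -> 0 < Cost T c (succs T u).

Lemma run_prob_cons v w s : succs T v != set0 ->
  run_prob T r B v (w :: s) = p v w * run_prob T r B w s.
Proof. by move=> /negbTE /= ->. Qed.

(** [Cost_pos] speaks only through runs, so a possible run has to be exhibited first. *)
Lemma Cost_pos_head n v : deep n v -> Cost_pos n v -> succs T v != set0 ->
  0 < Cost T c (succs T v).
Proof. by move=> /exists_run[s s0] /(_ s s0 v); apply; rewrite mem_head. Qed.

Lemma Cost_pos_step n v w : succs T v != set0 -> 0 < p v w ->
  Cost_pos n.+1 v -> Cost_pos n w.
Proof.
move=> S0 pw pos s s0 u us; have ws : (size (w :: s) <= n.+1)%N.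
  by rewrite /= ltnS size_bseq.
apply: (pos (Bseq ws)); first by rewrite run_prob_cons // mulr_gt0.
by rewrite inE us orbT.
Qed.

(** Multiplied by [Cost T c (succs T v)], the first factor of [alpha] becomes
    [weight v w * Cost T c w], whose mean is that same cost. *)
Lemma mean_alpha n v : deep n v -> Cost_pos n v ->
  mean_upto n v (alpha T c r v) = 1.
Proof.
move: n v; apply: run_ind => [n v _ S0 _|n v dv S0 IH pos].
  by rewrite mean_upto_leaf // alpha_nil.
have CS := lt0r_neq0 (Cost_pos_head dv pos S0).
rewrite mean_upto_step //; apply: (mulIf CS).
rewrite mul1r -[RHS](sum_step_Cost S0) mulr_suml.
under eq_bigr do rewrite -mulrA.
apply: sum_step_eq => w pw.
have [_ /(_ (Cost_pos_step S0 pw pos)) E1] := IH w pw.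
rewrite (eq_mean_upto _ _ (alpha_cons v w)) mean_upto_scale E1 mulr1 -mulrA.
by rewrite divfK.
Qed.

Definition max_alpha_upto n v : R :=
  \big[Num.max/0]_(s : n.-bseq {set V} | 0 < run_prob T r B v s)
    alpha T c r v s.

Lemma max_alpha_upto_ge0 n v : 0 <= max_alpha_upto n v.
Proof. exact: bigmax_ge_id. Qed.

Lemma max_alpha_upto_ge1 n v : deep n v -> Cost_pos n v ->
  1 <= max_alpha_upto n v.
Proof.
move=> dv pos; rewrite -(mean_alpha dv pos) -[leRHS](mean_upto_cst _ dv).
apply: ler_sum => s _; have := run_prob_ge0 T r_gt0 B_gt0 v s.
rewrite le_eqVlt => /predU1P[<-|s0]; first by rewrite !mul0r.
rewrite ler_pM2l //.
exact: (@le_bigmax_cond _ _ _ 0 s _ (fun t : n.-bseq _ => alpha T c r v t)).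
Qed.

(** The nonnegative factor [q] passes inside the maximum, and [q] times [alpha] of a run from [w] is
    [alpha] of the run from [v] that first selects [w]. *)
Lemma max_alpha_upto_step n v w : succs T v != set0 -> 0 < p v w ->
  weight v w * (Cost T c w / Cost T c (succs T v)) * max_alpha_upto n w
    <= max_alpha_upto n.+1 v.
Proof.
move=> S0 pw; set q := weight v w * _.
have q0 : 0 <= q by rewrite mulr_ge0 ?weight_ge0 // divr_ge0 ?Cost_ge0.
rewrite {1}/max_alpha_upto; elim/big_ind: _ => [|x y qx qy|s s0].
(* The default value 0 of the maximum. *)
- by rewrite mulr0 max_alpha_upto_ge0.
- by rewrite maxr_pMr // ge_max qx.
have ws : (size (w :: s) <= n.+1)%N by rewrite /= ltnS size_bseq.
rewrite -alpha_cons.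
apply: (@le_bigmax_cond _ _ _ 0 (Bseq ws) _
  (fun t : n.+1.-bseq _ => alpha T c r v t)).
by rewrite run_prob_cons // mulr_gt0.
Qed.

Lemma second_moment n v : deep n v -> Cost_pos n v ->
  mean_upto n v (fun s => estimator v s ^+ 2)
    <= max_alpha_upto n v * Cost T c v ^+ 2.
Proof.
move: n v; apply: run_ind => [n v dv S0 pos|n v dv S0 IH pos].
  rewrite mean_upto_leaf // estimator_nil Cost_succs S0 /Cost big_set0 addr0.
  by rewrite ler_peMl ?sqr_ge0 // max_alpha_upto_ge1.
have M1 := max_alpha_upto_ge1 dv pos; have CS := Cost_pos_head dv pos S0.
rewrite mean_upto_step // Cost_succs.
set M := max_alpha_upto _ _ in M1 *; set CSv := Cost T c (succs T v) in CS *.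
have cv : 0 <= wt c v by apply: sumr_ge0.
(* The intermediate bound is affine in [weight v w * Cost T c w], whose mean is known exactly. *)
apply: (@le_trans _ _ (\sum_w p v w * (wt c v ^+ 2
    + (2 * wt c v + M * CSv) * (weight v w * Cost T c w)))).
  apply: sum_step_le => w pw.
  have [dw /(_ (Cost_pos_step S0 pw pos)) Ew] := IH w pw.
  rewrite (eq_mean_upto _ _ (fun s => congr1 (fun x => x ^+ 2)
    (estimator_cons v w s))).
  rewrite mean_upto_sqr // mean_estimator //.
  have Mw := max_alpha_upto_step n S0 pw; rewrite -/M -/CSv in Mw.
  have W0 : 0 <= weight v w * Cost T c w by rewrite mulr_ge0 ?weight_ge0
    ?Cost_ge0.
  (* The induction hypothesis followed by [Mw] times [CSv * (weight v w * Cost T c w)]: one of the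
     two factors [weight v w * Cost T c w] is absorbed into [M]. *)
  have : weight v w ^+ 2 * mean_upto n w (fun s => estimator w s ^+ 2)
      <= M * CSv * (weight v w * Cost T c w).
    apply: le_trans (ler_wpM2l (sqr_ge0 _) Ew) _.
    rewrite -[leRHS]mulrA.
    apply: le_trans (ler_wpM2r (mulr_ge0 (ltW CS) W0) Mw).
    rewrite le_eqVlt; apply/orP; left; apply/eqP.
    by field; rewrite lt0r_neq0.
  lra.
have -> : \sum_w p v w * (wt c v ^+ 2
    + (2 * wt c v + M * CSv) * (weight v w * Cost T c w))
  = wt c v ^+ 2 + (2 * wt c v + M * CSv) * CSv.
  under eq_bigr do rewrite mulrDr [p v _ * wt c v ^+ 2]mulrC mulrCA.
  by rewrite big_split /= -!mulr_sumr sum_step_prob // mulr1 sum_step_Cost.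
(* This product is exactly the gap between [M * (wt c v + CSv) ^+ 2] and the bound reached. *)
have : 0 <= (M - 1) * (wt c v ^+ 2 + 2 * wt c v * CSv).
  rewrite mulr_ge0 ?subr_ge0 // addr_ge0 ?sqr_ge0 //.
  by rewrite !mulr_ge0 // ltW.
lra.
Qed.

End Estimator.

(** * From the second moment to the squared coefficient of variation *)

Theorem theorem7 (R : realFieldType) (V : finType) (T : rootedTree V)
    (c r : V -> R) (B : nat) (v : {set V})
    (c_ge0 : forall u, 0 <= c u)
    (r_gt0 : forall u, 0 < r u)
    (B_gt0 : (1 <= B)%N)
    (v_hyper : hypernode T v)
    (v_neq0 : v != set0)
    (v_cost : 0 < Cost T c v)
    (succs_cost : forall s : run V, s \in possible_runs T r B v ->
       forall u : {set V}, u \in v :: s -> succs T u != set0 ->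
       0 < Cost T c (succs T u)) :
  CV2 T r B v (fun s => #|v|%:R * C_SEI T c r v s)
    <= max_alpha T c r B v - 1.
Proof.
have dv : deep T #|V| v by move=> u _; apply: leq_addl.
have pos : Cost_pos T c r B #|V| v.
  by move=> s s0; apply: succs_cost; rewrite inE.
have -> : max_alpha T c r B v = max_alpha_upto T c r B #|V| v.
  by apply: eq_bigl => s; rewrite inE.
have EX : mean T r B v (estimator T c r v) = Cost T c v.
  exact: mean_estimator.
have M2 := second_moment c_ge0 r_gt0 B_gt0 dv pos.
rewrite /CV2 /variance -/(estimator T c r v) EX.
have -> : mean T r B v (fun s => (estimator T c r v s - Cost T c v) ^+ 2)
    = mean_upto T r B #|V| v (fun s => estimator T c r v s ^+ 2)
      - Cost T c v ^+ 2.
  (* The centred variable is put in the form [a + b * X s] of [mean_upto_sqr]. *)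
  transitivity (mean_upto T r B #|V| v
      (fun s => (- Cost T c v + 1 * estimator T c r v s) ^+ 2)).
    by apply: eq_mean_upto => s; rewrite mul1r addrC.
  by rewrite mean_upto_sqr // mean_estimator //; ring.
rewrite ler_pdivrMr ?exprn_gt0 // mulrBl mul1r.
exact: lerB.
Qed.
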